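(* Let $(G,M)$ be a marked permutation graph on at least six vertices and let $e\in E(M)$. If $e$ is contained in every $M$-copy of $C_4$ in $G$, then $e$ is contained in an $M$-copy of $P_{10}$ in $G$.
   Context: Graphs are finite. $P_{10}$ denotes the Petersen graph and $C_4$ the 4-cycle. A marked permutation graph is a pair $(G,M)$ where $G$ is a cubic graph and $M$ is a perfect matching of $G$ (a distinguished matching) such that $G-E(M)$ is the disjoint union of two cycles, neither of which has a chord in $G$. An $M$-copy of $P_{10}$ (also written $M$-$P_{10}$) is a subgraph of $G$ that is isomorphic to a subdivision of $P_{10}$ and is composed of the two cycles of $G-E(M)$ together with five edges of $M$. An $M$-copy of $C_4$ (also written $M$-$C_4$) is a 4-cycle in $G$ that uses two edges of $M$. *)

(* Defs.v *)
From HB Require Import structures.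
From mathcomp Require Import all_boot all_order all_algebra.

Set Implicit Arguments.
Unset Strict Implicit.
Unset Printing Implicit Defensive.

(* A graph is given by its vertex type V and its set of edges, each edge being
   the set of its two ends. A set of edges H over V also denotes the spanning
   graph (V, H). *)
Definition simple_graph (V : finType) (E : {set {set V}}) : Prop :=
  forall f, f \in E -> #|f| = 2.

Definition cubic (V : finType) (E : {set {set V}}) : Prop :=
  forall v : V, #|[set f in E | v \in f]| = 3.

Definition perfect_matching (V : finType) (E M : {set {set V}}) : Prop :=
  M \subset E /\ forall v : V, #|[set f in M | v \in f]| = 1.

(* A cycle is listed by its vertices in cyclic order. *)
Definition is_cycle (V : finType) (c : seq V) : bool := (2 < size c) && uniq c.

Definition cycle_edges (V : finType) (c : seq V) : {set {set V}} :=
  [set [set x; next c x] | x in c].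

Definition chordless (V : finType) (E : {set {set V}}) (c : seq V) : Prop :=
  forall f, f \in E -> f \subset c -> f \in cycle_edges c.

Definition marked_permutation_graph (V : finType) (E M : {set {set V}}) : Prop :=
  [/\ simple_graph E, cubic E, perfect_matching E M
    & exists c1 c2 : seq V,
      [/\ is_cycle c1 /\ is_cycle c2,
          [disjoint c1 & c2] /\ (forall x, x \in c1 ++ c2),
          E :\: M = cycle_edges c1 :|: cycle_edges c2
        & chordless E c1 /\ chordless E c2]].

(* Edges of the path with successive vertices x :: s. *)
Definition path_edges (V : finType) (x : V) (s : seq V) : {set {set V}} :=
  [set [set p.1; p.2] | p in zip (x :: s) s].

(* For a simple graph (U, X), (V, H) is isomorphic to a subdivision of it: every edge uv of X is
   replaced by a path from phi u to phi v with list of inner vertices P u v;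
   the paths have pairwise disjoint interiors, which avoid the branch vertices
   phi u, and they make up the whole graph. *)
Definition is_subdivision (U V : finType)
    (X : {set {set U}}) (H : {set {set V}}) : Prop :=
  exists (phi : U -> V) (P : U -> U -> seq V),
  [/\ injective phi,
      forall u v, [set u; v] \in X ->
        [/\ uniq (P u v), P v u = rev (P u v)
          & forall w, phi w \notin P u v],
      forall u v u' v', [set u; v] \in X -> [set u'; v'] \in X ->
        [set u; v] != [set u'; v'] -> [disjoint P u v & P u' v'],
      forall x, (exists u, x = phi u) \/
        (exists u v, [set u; v] \in X /\ x \in P u v)
    & H = \bigcup_(u : U) \bigcup_(v : U | [set u; v] \in X)
            path_edges (phi u) (rcons (P u v) (phi v))].

(* The Petersen graph: an outer 5-cycle, an inner pentagram, five spokes. *)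
Definition petersen : {set {set bool * 'Z_5}} :=
  [set [set (false, i); (false, (i + 1)%R)] | i : 'Z_5] :|:
  [set [set (true, i); (true, (i + 2)%R)] | i : 'Z_5] :|:
  [set [set (false, i); (true, i)] | i : 'Z_5].

Definition M_copy_P10 (V : finType) (E M H : {set {set V}}) : Prop :=
  is_subdivision petersen H /\
  exists F : {set {set V}}, [/\ F \subset M, #|F| = 5 & H = (E :\: M) :|: F].

Definition M_copy_C4 (V : finType) (E M C : {set {set V}}) : Prop :=
  (exists c : seq V, [/\ is_cycle c, size c = 4 & C = cycle_edges c]) /\
  C \subset E /\ #|C :&: M| = 2.

(* Main.v *)
Require Import Defs.
From HB Require Import structures.
From mathcomp Require Import all_boot all_order all_algebra.
From mathcomp Require Import zify.

(** Chordlessness forces every edge of M to join the two cycles, so M is the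
    graph of a bijection m between them. Let e join a and m a, and cut both
    cycles there: they become a :: s1 and m a :: s2, and m induces a
    permutation, comparing the order of s1 with the order of the partners in s2.

    An M-copy of C4 that misses e is the same thing as two neighbours of s1
    whose partners are neighbours in s2. An M-copy of P10 through e is the same
    thing as an occurrence of the pattern 3142 or 2413 in the permutation: in
    cyclic order, with the ends of e in position 0, the five chosen edges then
    join position 2j of the first cycle to position j of the second, or to
    position -j, where positions are read modulo 5, and this is how the spokes
    of the Petersen graph join its pentagon to its pentagram. Reversing s2
    exchanges the two patterns, so only one of them has to be turned into a
    subdivision ([petersen_copy]).

    It remains to see that a permutation of at least two points which avoids
    both patterns (a separable permutation) has two neighbours with consecutive
    values ([consecutive_or_pattern]). Such a permutation can be cut into a left
    and a right part with all values on the left smaller than all values on the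
    right, or all larger ([separable_split]). Recursing into a part with at
    least two points ends at two neighbours, and no value of the other part can
    come between theirs. *)

Set Implicit Arguments.
Unset Strict Implicit.
Unset Printing Implicit Defensive.

(** * Separable permutations *)

Definition linear_on (T : eqType) (r : rel T) (s : seq T) : Prop :=
  [/\ irreflexive r, transitive r
    & {in s &, forall x y, x != y -> r x y || r y x}].

(** The same pattern for the converse relation is 2413. *)
Definition pattern3142 (T : eqType) (r : rel T) (s : seq T) : Prop :=
  exists x1 x2 x3 x4,
    subseq [:: x1; x2; x3; x4] s /\ [/\ r x2 x4, r x4 x1 & r x1 x3].

(** In the terminology of permutation patterns, s is the direct sum of A and B,
    and for the converse relation it is their skew sum. *)
Definition sum_split (T : eqType) (r : rel T) (s : seq T) : Prop :=
  exists A B, [/\ s = A ++ B, A != [::], B != [::] & allrel r A B].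

Definition converse (T : eqType) (r : rel T) : rel T := fun x y => r y x.

Lemma linear_converse (T : eqType) (r : rel T) s :
  linear_on r s -> linear_on (converse r) s.
Proof.
case=> irr tr tot; split=> // [y x z /= ryx rzy|x y xs ys xy].
  exact: tr rzy ryx.
by rewrite orbC tot.
Qed.

Lemma linear_sub (T : eqType) (r : rel T) s s' :
  {subset s' <= s} -> linear_on r s -> linear_on r s'.
Proof.
by move=> sub [irr tr tot]; split=> // x y /sub xs /sub ys; apply: tot.
Qed.

Lemma pattern_subseq (T : eqType) (r : rel T) s s' :
  subseq s' s -> pattern3142 r s' -> pattern3142 r s.
Proof.
move=> sub [x1 [x2 [x3 [x4 [sub' rs]]]]]; exists x1, x2, x3, x4; split=> //.
exact: subseq_trans sub' sub.
Qed.

Lemma nallrel_witness (T : eqType) (r : rel T) A x : ~~ allrel r A [:: x] ->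
  exists2 a, a \in A & ~~ r a x.
Proof. by rewrite allrel1r => /allPn. Qed.

Lemma nonempty_mem (T : eqType) (s : seq T) : s != [::] -> exists x, x \in s.
Proof. by case: s => // x s _; exists x; rewrite mem_head. Qed.

Lemma subseq4 (T : eqType) (a b c d : T) A B C D :
  a \in A -> b \in B -> c \in C -> d \in D ->
  subseq [:: a; b; c; d] (A ++ B ++ C ++ D).
Proof.
move=> aA bB cC dD.
rewrite -[[:: a; b; c; d]]/([:: a] ++ [:: b] ++ [:: c] ++ [:: d]).
by do 3![apply: cat_subseq; first by rewrite sub1seq]; rewrite sub1seq.
Qed.

(** If x lies below A, then it can be cut off. Otherwise a direct cut of
    A x extends to the whole list, since B lies above A. In a skew cut of A x
    the last part is D x with D below C. When x is not below D, some d in D is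
    below x, and c d b x with c in C and b in B is an occurrence of 3142. *)
Lemma extend_sum_split (T : eqType) (r : rel T) (A B : seq T) (x : T) :
  linear_on r (A ++ rcons B x) -> uniq (A ++ rcons B x) ->
  A != [::] -> B != [::] -> allrel r A B ->
  sum_split r (rcons A x) \/ sum_split (converse r) (rcons A x) ->
  [\/ sum_split r (A ++ rcons B x), sum_split (converse r) (A ++ rcons B x)
    | pattern3142 r (A ++ rcons B x)].
Proof.
move=> [irr tr tot] Us A0 B0 rAB; set s := A ++ rcons B x.
have memA a : a \in A -> a \in s by move=> aA; rewrite mem_cat aA.
have xs : x \in s by rewrite mem_cat mem_rcons mem_head orbT.
have neqx a : a \in A -> a != x.
  move=> aA; apply: contraTneq Us => ax; rewrite cat_uniq negb_and orbC.
  rewrite negb_and negbK; apply/orP; left; apply/orP; left.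
  apply/hasP; exists x.
    by rewrite mem_rcons mem_head.
  by rewrite /= -ax.
(* If x lies below all of A, then it lies below B too, and [:: x] is a part. *)
have low : (forall a, a \in A -> r x a) -> sum_split (converse r) s.
  move=> xA; exists (A ++ B), [:: x]; split=> //.
  - by rewrite -catA cats1.
  - by rewrite -size_eq0 size_cat addn_eq0 negb_and size_eq0 A0.
  - rewrite allrel1r all_cat; apply/andP; split; apply/allP => y yA;
      first exact: xA.
    have [a aA] := nonempty_mem A0.
    by apply: tr (xA a aA) _; apply: (allrelP rAB).
case=> [[C [D [def C0 D0 rCD]]]|[C [D [def C0 D0 rCD]]]].
- case/lastP: D def D0 rCD => // D x';
    rewrite -rcons_cat => /rcons_inj[defA <-] _ rCD.
  constructor 1; exists C, (D ++ rcons B x); split=> //.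
  + by rewrite /s defA catA.
  + by rewrite -size_eq0 size_cat size_rcons addnS.
  move: rCD rAB; rewrite defA -cats1 -[rcons B x]cats1 !allrel_catr allrel_catl.
  by move=> /andP[-> ->] /andP[-> _].
- case/lastP: D def D0 rCD => // D x';
    rewrite -rcons_cat => /rcons_inj[defA <-] _ rCD.
  have [rDx|/nallrel_witness[d dD ndx]] := boolP (allrel (converse r) D [:: x]).
    constructor 2; apply: low => a; rewrite defA mem_cat => /orP[aC|aD].
      by apply: (allrelP rCD) => //; rewrite mem_rcons mem_head.
    by apply: (allrelP rDx) => //; rewrite mem_head.
  have dA : d \in A by rewrite defA mem_cat dD orbT.
  have rdx : r d x.
    by have := tot d x (memA d dA) xs (neqx d dA);
      rewrite [r x d](negbTE ndx) orbF.
  have [[c cC] [b bB]] := (nonempty_mem C0, nonempty_mem B0).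
  constructor 3; exists c, d, b, x; split.
    by rewrite /s defA -cats1 -catA subseq4 ?mem_head.
  split=> //; last by apply: (allrelP rAB); rewrite // defA mem_cat cC.
  by apply: (allrelP rCD); rewrite // mem_rcons mem_head.
Qed.

(** Remove the last entry x, cut the rest into A and B, and apply the induction
    hypothesis a second time, to A followed by x. This list is shorter because B
    is not empty. A skew cut of the rest is the same case for the converse
    relation, and the conclusion is invariant under passing to the converse. *)
Lemma separable_split (T : eqType) (r : rel T) (s : seq T) :
  linear_on r s -> uniq s -> 1 < size s ->
  (sum_split r s \/ sum_split (converse r) s) \/
  (pattern3142 r s \/ pattern3142 (converse r) s).
Proof.
have [n] := ubnP (size s); elim: n r s => // n IHn r s lesn lin Us gt1.
case/lastP: s lesn lin Us gt1 => // t x;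
  rewrite size_rcons ltnS => ltn lin Us gt0.
have [tr_t Ut] : linear_on r t /\ uniq t.
  split; last by move: Us; rewrite rcons_uniq => /andP[].
  by apply: linear_sub lin => y; rewrite mem_rcons in_cons orbC => ->.
have [] := leqP (size t) 1.
  case: t {IHn} gt0 ltn lin Us tr_t Ut => // y [|//] _ _ [irr tr tot] /=.
  rewrite inE andbT => yx _ _ _; left.
  have := tot y x; rewrite !inE !eqxx orbT => /(_ isT isT yx) /orP[ryx|rxy].
    by left; exists [:: y], [:: x]; split=> //; rewrite allrel1r /= ryx.
  by right; exists [:: y], [:: x]; split=> //;
    rewrite allrel1r /= /converse rxy.
move=> gt1; have subt : subseq t (rcons t x) by exact: subseq_rcons.
have step (q : rel T) : linear_on q (rcons t x) -> sum_split q t ->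
    (sum_split q (rcons t x) \/ sum_split (converse q) (rcons t x)) \/
    (pattern3142 q (rcons t x) \/ pattern3142 (converse q) (rcons t x)).
  move=> linq [A [B [deft A0 B0 qAB]]].
  have eqs : rcons t x = A ++ rcons B x by rewrite deft rcons_cat.
  have subA : subseq (rcons A x) (rcons t x).
    by rewrite eqs -!cats1 cat_subseq ?suffix_subseq.
  have ltA : size (rcons A x) < n.
    apply: leq_trans ltn; rewrite deft size_cat size_rcons -addn1.
    by case: B B0 {deft qAB eqs} => // b B _ /=; lia.
  have gtA : 1 < size (rcons A x) by rewrite size_rcons ltnS lt0n size_eq0.
  have linA := linear_sub (mem_subseq subA) linq.
  have UA := subseq_uniq subA Us.
  have [spl|[pat|pat]] := IHn q _ ltA linA UA gtA.
  - move: linq Us; rewrite eqs => linq Us.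
    by have [] := extend_sum_split linq Us A0 B0 qAB spl; auto.
  - by right; left; exact: pattern_subseq pat.
  - by right; right; exact: pattern_subseq pat.
have [[spl|spl]|[pat|pat]] := IHn r t ltn tr_t Ut gt1.
- exact: step.
- have [[]|[]] := step _ (linear_converse lin) spl; auto.
- by right; left; exact: pattern_subseq pat.
- by right; right; exact: pattern_subseq pat.
Qed.

(** The entries outside a part lie all above or all below it, so they cannot
    separate two values of the part. *)
Lemma consecutive_or_pattern (T : eqType) (r : rel T) (s : seq T) :
  linear_on r s -> uniq s -> 1 < size s ->
  (exists s1 x y s2, s = s1 ++ x :: y :: s2 /\
     {in s, forall z, ~~ (r x z && r z y) && ~~ (r y z && r z x)}) \/
  (pattern3142 r s \/ pattern3142 (converse r) s).
Proof.
have [n] := ubnP (size s); elim: n r s => // n IHn r s lesn lin Us gt1.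
have [spl|] := separable_split lin Us gt1; last by right.
have step (q : rel T) : linear_on q s -> sum_split q s ->
  (exists s1 x y s2, s = s1 ++ x :: y :: s2 /\
     {in s, forall z, ~~ (q x z && q z y) && ~~ (q y z && q z x)}) \/
  (pattern3142 q s \/ pattern3142 (converse q) s).
  move=> linq [A [B [defs A0 B0 qAB]]]; have [irr tr _] := linq.
  have anti x y : q x y -> q y x = false.
    by move=> qxy; apply/negP => /(tr _ _ _ qxy); rewrite irr.
  have subA : subseq A s by rewrite defs prefix_subseq.
  have subB : subseq B s by rewrite defs suffix_subseq.
  have [gtA|leA] := ltnP 1 (size A).
    have ltA : size A < n.
      move: lesn; rewrite defs size_cat;
        case: B B0 {defs qAB subB} => //= b B _; lia.
    have [|[pat|pat]] := IHn q A ltA (linear_sub (mem_subseq subA) linq)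
                           (subseq_uniq subA Us) gtA.
    - move=> [s1 [x [y [s2 [defA btw]]]]]; left; exists s1, x, y, (s2 ++ B).
      split; first by rewrite defs defA -catA.
      have xA : x \in A by rewrite defA mem_cat mem_head orbT.
      have yA : y \in A by rewrite defA mem_cat !inE eqxx !orbT.
      move=> z; rewrite defs mem_cat => /orP[/btw//|zB].
      by rewrite !(anti _ z) ?andbF // (allrelP qAB).
    - by right; left; exact: pattern_subseq pat.
    - by right; right; exact: pattern_subseq pat.
  have [gtB|leB] := ltnP 1 (size B).
    have ltB : size B < n.
      move: lesn; rewrite defs size_cat;
        case: A A0 {defs qAB subA leA} => //= b A _; lia.
    have [|[pat|pat]] := IHn q B ltB (linear_sub (mem_subseq subB) linq)
                           (subseq_uniq subB Us) gtB.
    - move=> [s1 [x [y [s2 [defB btw]]]]]; left; exists (A ++ s1), x, y, s2.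
      split; first by rewrite defs defB -catA.
      have xB : x \in B by rewrite defB mem_cat mem_head orbT.
      have yB : y \in B by rewrite defB mem_cat !inE eqxx !orbT.
      move=> z; rewrite defs mem_cat => /orP[zA|/btw//].
      by rewrite ![q _ z]anti // (allrelP qAB).
    - by right; left; exact: pattern_subseq pat.
    - by right; right; exact: pattern_subseq pat.
  left; case: A A0 leA defs {subA qAB} => // x [|//] _ _.
  case: B B0 leB {subB} => // y [|//] _ _ /= defs.
  exists [::], x, y, [::]; split=> // z; rewrite defs !inE => /orP[]/eqP->;
  by rewrite !irr ?andbF.
case: spl => spl; first exact: step.
have [[s1 [x [y [s2 [defs btw]]]]]|[]] := step _ (linear_converse lin) spl;
  auto.
left; exists s1, x, y, s2; split=> // z /btw.
by rewrite andbC /converse ![_ && r z _]andbC andbC [X in _ && ~~ X]andbC.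
Qed.

(** * Edges of paths and cycles *)

Lemma eq_set2P (T : finType) (a b x y : T) :
  [set a; b] = [set x; y] -> (a = x /\ b = y) \/ (a = y /\ b = x).
Proof.
move=> eq; have := set21 a b; have := set22 a b; rewrite {1 2}eq.
have := set21 x y; have := set22 x y; rewrite -{1 2}eq.
by do 4![case/set2P=> ?; subst]; auto.
Qed.

Lemma path_edgesP (V : finType) (x : V) (s : seq V) (f : {set V}) :
  reflect (exists2 p, p \in zip (x :: s) s & f = [set p.1; p.2])
          (f \in path_edges x s).
Proof. exact: (iffP imsetP). Qed.

Lemma path_edges0 (V : finType) (x : V) : path_edges x [::] = set0.
Proof. by apply/setP=> f; rewrite inE; apply/path_edgesP => -[]. Qed.

Lemma path_edges_cons (V : finType) (x y : V) (s : seq V) :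
  path_edges x (y :: s) = [set x; y] |: path_edges y s.
Proof.
apply/setP=> f; rewrite in_setU1; apply/path_edgesP/orP => /=.
  case=> p; rewrite inE => /predU1P[-> ->|ps ->]; first by rewrite eqxx; left.
  by right; apply/path_edgesP; exists p.
case=> [/eqP->|/path_edgesP[p ps ->]].
  by exists (x, y); rewrite ?mem_head.
by exists p; rewrite // inE ps orbT.
Qed.

Lemma path_edges_cat (V : finType) (x y : V) (s t : seq V) :
  path_edges x (s ++ y :: t) = path_edges x (rcons s y) :|: path_edges y t.
Proof.
elim: s x => [|z s IHs] x /=;
  first by rewrite !path_edges_cons path_edges0 setU0.
by rewrite !path_edges_cons IHs setUA.
Qed.

Lemma path_edges_rev (V : finType) (x y : V) (s : seq V) :
  path_edges x (rcons (rev s) y) = path_edges y (rcons s x).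
Proof.
elim: s x y => [|z s IHs] x y /=.
  by rewrite !path_edges_cons !path_edges0 setUC setUC [[set x; y]]setUC.
rewrite rev_cons -cats1 cat_rcons path_edges_cat IHs !path_edges_cons
  path_edges0.
by rewrite setU0 [[set y; z]]setUC [RHS]setUC.
Qed.

Lemma cycle_edges_path (V : finType) (x : V) (s : seq V) :
  uniq (x :: s) -> cycle_edges (x :: s) = path_edges x (rcons s x).
Proof.
move=> U; have szE : size (zip (x :: rcons s x) (rcons s x)) = (size s).+1.
  by rewrite size_zip /= !size_rcons; lia.
have nthE i : i <= size s -> nth (x, x) (zip (x :: rcons s x) (rcons s x)) i =
    (nth x (x :: s) i, next (x :: s) (nth x (x :: s) i)).
  move=> lei; rewrite nth_zip_cond szE ltnS lei.
  rewrite -[x :: rcons s x]/(rcons (x :: s) x).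
  rewrite next_nth mem_nth // index_uniq //.
  rewrite [in nth x (rcons (x :: s) x) i]nth_rcons /= ltnS lei.
  congr (_, _); rewrite nth_rcons; case: ltnP => // lesi.
  by rewrite nth_default ?if_same.
apply/setP=> f; apply/imsetP/path_edgesP => [[y ys ->]|[p ps ->]].
  have lei : index y (x :: s) <= size s.
    by rewrite -ltnS -[X in _ < X]/(size (x :: s)) index_mem.
  exists (y, next (x :: s) y) => //; rewrite -[y in (y, _)](nth_index x ys).
  by rewrite -[in next _ _](nth_index x ys) -nthE // mem_nth // szE.
have := index_mem p (zip (x :: rcons s x) (rcons s x));
  rewrite ps szE ltnS => lei.
exists (nth x (x :: s) (index p (zip (x :: rcons s x) (rcons s x)))).
  by rewrite mem_nth.
by rewrite -[in LHS](nth_index (x, x) ps) nthE.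
Qed.

Lemma cycle_edges_rot (V : finType) (c : seq V) n :
  uniq c -> cycle_edges (rot n c) = cycle_edges c.
Proof.
move=> U; apply/setP=> f.
by apply/imsetP/imsetP=> -[x xc ->]; exists x;
  rewrite ?next_rot ?mem_rot // -(mem_rot n).
Qed.

(** Traversing the second cycle backwards from its end of e is what exchanges
    the patterns 3142 and 2413. *)
Lemma cycle_edges_rev_tail (V : finType) (x : V) (s : seq V) :
  uniq (x :: s) -> cycle_edges (x :: rev s) = cycle_edges (x :: s).
Proof.
move=> U; rewrite !cycle_edges_path ?path_edges_rev //.
by move: U; rewrite /= mem_rev rev_uniq.
Qed.

(** When the walk closes up, the left-hand side is the edge set of the cycle
    listed by all phi w :: arc w in turn ([cycle_edges_path]). Walks that need
    not close up make the induction on the length possible. *)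
Lemma path_edges_traject (U V : finType) (nxt : U -> U) (phi : U -> V)
    (arc : U -> seq V) n u :
  path_edges (phi u)
    (rcons (arc u ++ flatten [seq phi w :: arc w | w <- traject nxt (nxt u) n])
           (phi (iter n.+1 nxt u)))
  = \bigcup_(w in traject nxt u n.+1)
      path_edges (phi w) (rcons (arc w) (phi (nxt w))).
Proof.
have bigcons (x : U) s (F : U -> {set {set V}}) :
    \bigcup_(w in x :: s) F w = F x :|: \bigcup_(w in s) F w.
  apply/setP=> f; rewrite inE; apply/bigcupP/orP.
    case=> w; rewrite inE => /predU1P[->|ws] fw; [by left|right].
    by apply/bigcupP; exists w.
  case=> [fx|/bigcupP[w ws fw]]; first by exists x; rewrite ?mem_head.
  by exists w; rewrite // inE ws orbT.
elim: n u => [|n IHn] u.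
  rewrite /= cats0 bigcons [X in _ :|: X]big_pred0 ?setU0 // => w.
rewrite trajectS bigcons -IHn /= rcons_cat /= path_edges_cat.
by rewrite -!iterSr.
Qed.

(** * Subdivisions of the Petersen graph *)

(** The two 5-cycles of the Petersen graph, oriented: the pentagon is the orbit
    of (false, 0) and the pentagram is the orbit of (true, 0). *)
Definition pnext (u : bool * 'Z_5) : bool * 'Z_5 :=
  (u.1, u.2 + (if u.1 then 2 else 1))%R.

Definition pcycle (b : bool) := traject pnext (b, 0%R) 5.

Lemma mem_pcycle u : u \in pcycle u.1.
Proof. by case: u => -[] [[|[|[|[|[|?]]]]]]. Qed.

(** An edge of the two 5-cycles has only one orientation as a step u -> pnext u.
    Hence the two tests in [arc_between] exclude each other. *)
Lemma pnext_ne2 u : (u == pnext (pnext u)) = false.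
Proof. by case: u => -[] [[|[|[|[|[|?]]]]]]. Qed.

Lemma petersenP u v : reflect
  [\/ v = pnext u, u = pnext v | u.1 != v.1 /\ u.2 = v.2]
  ([set u; v] \in petersen).
Proof.
rewrite !inE; apply: (iffP idP).
  case/orP=> [/orP[]|] /imsetP[i _] /eq_set2P[] [-> ->];
  by [constructor 1|constructor 2|constructor 3].
case: u v => [b i] [c j] [-> | -> | [/= bc <-]] /=.
- apply/orP; left; apply/orP.
  by case: b; [right|left]; apply/imsetP; exists i.
- rewrite setUC; apply/orP; left; apply/orP.
  by case: c; [right|left]; apply/imsetP; exists j.
- apply/orP; right; apply/imsetP; exists i => //.
  by case: b c bc => [] [] // _; rewrite setUC.
Qed.

Definition arc_between (V : finType) (arc : bool * 'Z_5 -> seq V) u v :=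
  if v == pnext u then arc u else if u == pnext v then rev (arc v) else [::].

Lemma arc_between_next (V : finType) (arc : bool * 'Z_5 -> seq V) u :
  arc_between arc u (pnext u) = arc u.
Proof. by rewrite /arc_between eqxx. Qed.

Lemma arc_between_prev (V : finType) (arc : bool * 'Z_5 -> seq V) u :
  arc_between arc (pnext u) u = rev (arc u).
Proof. by rewrite /arc_between pnext_ne2 eqxx. Qed.

Lemma arc_betweenP (V : finType) (arc : bool * 'Z_5 -> seq V) u v :
  arc_between arc u v = [::] \/
  exists w, [set u; v] = [set w; pnext w] /\ arc_between arc u v =i arc w.
Proof.
rewrite /arc_between; case: eqP => [->|_]; first by right; exists u.
case: eqP => [->|_]; last by left.
by right; exists v; split; [rewrite setUC | move=> x; rewrite mem_rev].
Qed.

Lemma arc_between_spoke (V : finType) (arc : bool * 'Z_5 -> seq V) u v :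
  u.1 != v.1 -> arc_between arc u v = [::].
Proof.
move=> uv; rewrite /arc_between; case: eqP => [eq | _].
  by rewrite eq eqxx in uv.
by case: eqP => // eq; rewrite eq eqxx in uv.
Qed.

(** The subdivided graph is given by its branch vertices phi u and by the inner
    vertices arc u of the path from phi u to phi (pnext u). The spokes are not
    subdivided, because they are edges of the matching. *)
Definition subdivided_cycle (V : finType) (phi : bool * 'Z_5 -> V)
    (arc : bool * 'Z_5 -> seq V) (b : bool) : seq V :=
  flatten [seq phi u :: arc u | u <- pcycle b].

Definition spokes (V : finType) (phi : bool * 'Z_5 -> V) : {set {set V}} :=
  [set [set phi (false, i); phi (true, i)] | i : 'Z_5].

Lemma cycle_edges_subdivided (V : finType) (phi : bool * 'Z_5 -> V) arc b :
  uniq (subdivided_cycle phi arc b) ->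
  cycle_edges (subdivided_cycle phi arc b) =
  \bigcup_(u | u.1 == b) path_edges (phi u) (rcons (arc u) (phi (pnext u))).
Proof.
move=> U; rewrite cycle_edges_path //.
have := path_edges_traject pnext phi arc 4 (b, 0%R).
have -> : iter 5 pnext (b, 0%R) = (b, 0%R) by apply/eqP; case: b {U}.
move=> arcsE; apply: (etrans arcsE).
apply: eq_bigl => u.
apply/idP/eqP => [|<-]; last exact: mem_pcycle.
have: all (fun u => u.1 == b) (traject pnext (b, 0%R) 5) by rewrite /= !eqxx.
by move/allP=> h /h /eqP.
Qed.

(** Used for the ten lists phi u :: arc u, which make up the two cycles: that
    they are disjoint gives all the conditions of a subdivision that concern
    distinctness. *)
Lemma flatten_uniq_disjoint (I T : eqType) (w : I -> seq T) (s : seq I) :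
  uniq s -> uniq (flatten [seq w i | i <- s]) ->
  {in s, forall i, uniq (w i)} /\
  {in s &, forall i j x, x \in w i -> x \in w j -> i = j}.
Proof.
elim: s => [|k s IHs] //= /andP[ks Us]; rewrite cat_uniq => /and3P[Uk dis Ufl].
have [IH1 IH2] := IHs Us Ufl.
have sep i x : i \in s -> x \in w k -> x \in w i -> False.
  move=> is_ xk xi; case/hasP: dis; exists x => //.
  by apply/flattenP; exists (w i) => //; apply: map_f.
split=> [i|i j]; first by rewrite inE => /predU1P[->|/IH1].
rewrite !inE => /predU1P[->|is_] /predU1P[->|js] x xi xj //.
- by case: (sep j x).
- by case: (sep i x).
- exact: IH2 xi xj.
Qed.

Lemma subdivided_disjoint (V : finType) (phi : bool * 'Z_5 -> V) arc :
  uniq (subdivided_cycle phi arc false ++ subdivided_cycle phi arc true) ->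
  (forall u, uniq (phi u :: arc u)) /\
  (forall u v x, x \in phi u :: arc u -> x \in phi v :: arc v -> u = v).
Proof.
have mem_us u : u \in pcycle false ++ pcycle true.
  by rewrite mem_cat; case: u => [[] i]; rewrite (mem_pcycle (_, i)) ?orbT.
rewrite -flatten_cat -map_cat => U;
  have [//|Uw disw] := flatten_uniq_disjoint _ U.
by split=> [u|u v x]; [exact: Uw|exact: disw].
Qed.

Lemma branch_injective (V : finType) (phi : bool * 'Z_5 -> V) arc :
  uniq (subdivided_cycle phi arc false ++ subdivided_cycle phi arc true) ->
  injective phi.
Proof.
case/subdivided_disjoint=> _ disw u v eq.
by apply: (disw u v (phi u)); rewrite ?mem_head // eq mem_head.
Qed.

Lemma petersen_subdivision (V : finType) (phi : bool * 'Z_5 -> V) arc :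
  uniq (subdivided_cycle phi arc false ++ subdivided_cycle phi arc true) ->
  (forall x,
     x \in subdivided_cycle phi arc false ++ subdivided_cycle phi arc true) ->
  is_subdivision petersen
    (cycle_edges (subdivided_cycle phi arc false) :|:
     cycle_edges (subdivided_cycle phi arc true) :|: spokes phi).
Proof.
move=> Uc cov; have [Uw disw] := subdivided_disjoint Uc.
have [] : uniq (subdivided_cycle phi arc false) /\
          uniq (subdivided_cycle phi arc true).
  by move: Uc; rewrite cat_uniq => /and3P[-> _ ->].
move=> Uf Ut; rewrite !cycle_edges_subdivided //.
have phi_arc u v : phi u \notin arc v.
  apply/negP => uv; have eq : u = v.
    by apply: (disw u v (phi u)); rewrite ?mem_head // inE uv orbT.
  by move: uv (Uw u); rewrite -eq /= => ->.
exists phi, (arc_between arc); split.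
- exact: branch_injective Uc.
- move=> u v /petersenP uv; split.
  + rewrite /arc_between; case: eqP => _; first by case/andP: (Uw u).
    by case: eqP => // _; rewrite rev_uniq; case/andP: (Uw v).
  + rewrite /arc_between; case: eqP => [->|_]; first by rewrite pnext_ne2 revK.
    by case: eqP.
  + move=> w; have [->|[z [_ ->]]] := arc_betweenP arc u v;
      first by rewrite in_nil.
    exact: phi_arc.
- move=> u v u' v' _ _ ne; rewrite disjoint_has; apply/hasPn => x.
  have [->|[z [eqz ->]]] := arc_betweenP arc u v; first by rewrite in_nil.
  move=> xz; have [->|[z' [eqz' ->]]] := arc_betweenP arc u' v'.
    by rewrite in_nil.
  apply: contraNN ne => xz'; rewrite eqz eqz'.
  by rewrite (disw z z' x) // inE ?xz ?xz' orbT.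
- move=> x; have := cov x;
    rewrite -flatten_cat -map_cat => /flattenP[_ /mapP[u _ ->]].
  rewrite inE => /predU1P[->|xu]; [by left; exists u|right].
  exists u, (pnext u); rewrite arc_between_next; split=> //.
  by apply/petersenP; constructor 1.
apply/setP=> f; rewrite !inE; apply/idP/bigcupP.
  case/orP=> [/orP[]/bigcupP[u _ fu]|/imsetP[i _ ->]].
  1,2: by exists u => //; apply/bigcupP; exists (pnext u);
    [apply/petersenP; constructor 1|rewrite arc_between_next].
  exists (false, i) => //; apply/bigcupP; exists (true, i).
    by apply/petersenP; constructor 3.
  by rewrite arc_between_spoke //= path_edges_cons path_edges0 setU0 inE.
case=> u _ /bigcupP[v /petersenP uv].
have arcs w : f \in path_edges (phi w) (rcons (arc w) (phi (pnext w))) ->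
  [|| f \in \bigcup_(u | u.1 == false)
              path_edges (phi u) (rcons (arc u) (phi (pnext u))),
      f \in \bigcup_(u | u.1 == true)
              path_edges (phi u) (rcons (arc u) (phi (pnext u)))
    | f \in spokes phi].
  move=> fw; case Ew: w.1; apply/or3P; [constructor 2|constructor 1];
  by apply/bigcupP; exists w; rewrite ?Ew.
rewrite -orbA; case: uv => [->|->|[]].
- by rewrite arc_between_next => /arcs.
- by rewrite arc_between_prev path_edges_rev => /arcs.
move=> uv; rewrite arc_between_spoke //= path_edges_cons path_edges0 setU0 inE.
case: u v uv => b i [c j] /= bc eqi /eqP->; subst j.
apply/or3P; constructor 3; apply/imsetP; exists i => //.
by case: b c bc => [] [] // _; rewrite setUC.
Qed.

(** * From positions in a list to sublists *)

Lemma subseq_consP (T : eqType) (x : T) p s :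
  subseq (x :: p) s -> exists s1 s2, s = s1 ++ x :: s2 /\ subseq p s2.
Proof.
elim: s => [|y s IHs] //=; case: eqP => [<-|_] sub; first by exists [::], s.
by have [s1 [s2 [-> sub2]]] := IHs sub; exists (y :: s1), s2.
Qed.

Lemma subseq4P (T : eqType) (x1 x2 x3 x4 : T) s :
  subseq [:: x1; x2; x3; x4] s -> exists S0 S1 S2 S3 S4,
  s = S0 ++ x1 :: S1 ++ x2 :: S2 ++ x3 :: S3 ++ x4 :: S4.
Proof.
case/subseq_consP=> S0 [s1 [-> /subseq_consP[S1 [s2 [->]]]]].
case/subseq_consP=> S2 [s3 [-> /subseq_consP[S3 [S4 [-> _]]]]].
by exists S0, S1, S2, S3, S4.
Qed.

(** A list of entries of s is the image under nth of their positions, and an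
    increasing list of positions is a sublist of iota. *)
Lemma index_sorted_subseq (T : eqType) (p s : seq T) :
  {subset p <= s} -> sorted ltn [seq index x s | x <- p] -> subseq p s.
Proof.
case: s => [|x0 s0]; first by case: p => // x p /(_ x (mem_head _ _)).
set s := x0 :: s0 => sub srt.
have -> : p = [seq nth x0 s i | i <- [seq index x s | x <- p]].
  by rewrite -map_comp map_id_in // => x /sub xs /=; rewrite nth_index.
set q := map _ p; suff: subseq q (iota 0 (size s)).
  by move/(map_subseq (nth x0 s)); rewrite -/(mkseq _ _) mkseq_nth.
have -> : q = [seq i <- iota 0 (size s) | i \in q].
  apply: (irr_sorted_eq ltn_trans ltnn srt).
    by rewrite sorted_filter ?iota_ltn_sorted //; apply: ltn_trans.
  move=> i; rewrite mem_filter mem_iota /= add0n andb_idr // =>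
    /mapP[x /sub xs ->].
  by rewrite index_mem.
exact: filter_subseq.
Qed.

Lemma index_consecutive (T : eqType) (u v : T) (s : seq T) :
  uniq s -> u \in s -> v \in s -> index u s < index v s ->
  {in s, forall w, ~~ ((index u s < index w s) && (index w s < index v s))} ->
  exists p q, s = p ++ u :: v :: q.
Proof.
move=> Us us vs ltuv btw; have ltv : index v s < size s by rewrite index_mem.
have eqv : index v s = (index u s).+1.
  apply/eqP; rewrite eqn_leq ltuv andbT leqNgt; apply/negP => lt2.
  have lts : (index u s).+1 < size s by exact: ltn_trans lt2 ltv.
  have := btw _ (mem_nth u lts); rewrite index_uniq //; by rewrite ltnSn lt2.
exists (take (index u s) s), (drop (index u s).+2 s).
rewrite -{1}(cat_take_drop (index u s) s) (drop_nth u) ?index_mem //.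
by rewrite nth_index // (drop_nth u) -eqv // nth_index.
Qed.

Lemma consecutive_cycle_edge (V : finType) (x u v : V) p q :
  uniq (x :: p ++ u :: v :: q) ->
  [set u; v] \in cycle_edges (x :: p ++ u :: v :: q).
Proof.
move=> U; rewrite cycle_edges_path // rcons_cat /= path_edges_cat
  path_edges_cons.
by rewrite !inE eqxx orbT.
Qed.

(** * Marked permutation graphs *)

Lemma matching_partner (V : finType) (E M : {set {set V}}) :
  simple_graph E -> perfect_matching E M ->
  exists m : V -> V,
  [/\ forall x, [set x; m x] \in M, involutive m
    & forall x y, [set x; y] \in M -> y = m x].
Proof.
move=> sE [/subsetP sME pm].
have unique x f g : f \in M -> g \in M -> x \in f -> x \in g -> f = g.
  move=> fM gM xf xg; have /eqP/cards1P[h eqh] := pm x.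
  have: f \in [set h] by rewrite -eqh inE fM.
  have: g \in [set h] by rewrite -eqh inE gM.
  by rewrite !inE => /eqP-> /eqP->.
pose m x := odflt x [pick y | [set x; y] \in M].
have mM x : [set x; m x] \in M.
  rewrite /m; case: pickP => //= noy.
  have /eqP/cards1P[f eqf] := pm x.
  have : f \in [set f] by rewrite inE.
  rewrite -eqf inE => /andP[fM xf].
  have /eqP/cards2P[y [z [_ eqyz]]] := sE f (sME f fM).
  move: xf fM; rewrite eqyz => /set2P[]<-; first by rewrite [_ \in M]noy.
  by rewrite setUC [_ \in M]noy.
have muniq x y : [set x; y] \in M -> y = m x.
  move=> xyM; have /eq_set2P[[]|[]] // :=
    unique x _ _ xyM (mM x) (set21 _ _) (set21 _ _).
  by move=> <-.
exists m; split=> // x; apply/esym/muniq; by rewrite setUC.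
Qed.

(** The pattern 3142: x1, ..., x4 have their partners in the order
    x2, x4, x1, x3. With a in position 0, position j of the second cycle is thus
    matched to position 2j of the first. Naming a vertex of the second cycle
    (true, i) when its partner has position i, consecutive vertices of that
    cycle are (true, 2j) and (true, 2j + 2): the step of the pentagram. *)
Lemma petersen_copy (V : finType) (E M : {set {set V}}) (m : V -> V)
    (a x1 x2 x3 x4 : V) (s1 s2 : seq V) :
  (forall x, [set x; m x] \in M) ->
  uniq ((a :: s1) ++ m a :: s2) -> (forall x, x \in (a :: s1) ++ m a :: s2) ->
  E :\: M = cycle_edges (a :: s1) :|: cycle_edges (m a :: s2) ->
  subseq [:: x1; x2; x3; x4] s1 -> subseq [:: m x2; m x4; m x1; m x3] s2 ->
  exists H, M_copy_P10 E M H /\ [set a; m a] \in H.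
Proof.
move=> mM U cov eqEM /subseq4P[S0 [S1 [S2 [S3 [S4 eqs1]]]]].
case/subseq4P=> [T0 [T1 [T2 [T3 [T4 eqs2]]]]].
pose outer := [:: a; x1; x2; x3; x4].
pose phi (u : bool * 'Z_5) :=
  if u.1 then m (nth a outer u.2) else nth a outer u.2.
(* Inner arcs are indexed by i = 2j, which permutes T0, ..., T4. *)
pose arc (u : bool * 'Z_5) :=
  nth [::] (if u.1 then [:: T0; T3; T1; T4; T2]
            else [:: S0; S1; S2; S3; S4]) u.2.
have eqc1 : a :: s1 = subdivided_cycle phi arc false.
  by rewrite eqs1 /subdivided_cycle /= cats0.
have eqc2 : m a :: s2 = subdivided_cycle phi arc true.
  by rewrite eqs2 /subdivided_cycle /= cats0.
rewrite eqc1 eqc2 in U cov eqEM.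
have phi_inj := branch_injective U.
exists (E :\: M :|: spokes phi); split; last first.
  by rewrite inE; apply/orP; right; apply/imsetP; exists 0%R.
split; first by rewrite eqEM; exact: petersen_subdivision.
exists (spokes phi); split=> //.
  by apply/subsetP => _ /imsetP[i _ ->]; exact: mM.
rewrite card_imset ?card_ord // => i j /eq_set2P[[/phi_inj[]]|[/phi_inj]] //.
Qed.

Lemma four_cycle (V : finType) (E M : {set {set V}}) (m : V -> V) (x y : V) :
  (forall x, [set x; m x] \in M) ->
  M \subset E -> uniq [:: x; y; m y; m x] ->
  [set x; y] \in E :\: M -> [set m y; m x] \in E :\: M ->
  exists C, M_copy_C4 E M C /\ {subset cover C <= [:: x; y; m y; m x]}.
Proof.
move=> mM sME U xyE myxE; pose c := [:: x; y; m y; m x].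
have cE : cycle_edges c =
   [set [set x; y]; [set m y; m x]] :|: [set [set y; m y]; [set x; m x]].
  rewrite cycle_edges_path // !path_edges_cons path_edges0 setU0.
  by apply/setP=> f; rewrite !inE [[set m x; x]]setUC; do ![case: eqP => _ //=].
exists (cycle_edges c); split; first split.
- by exists c.
- move: xyE myxE; rewrite !inE => /andP[xyM xyE] /andP[myxM myxE]; split.
    by rewrite cE !subUset !sub1set xyE myxE !(subsetP sME).
  rewrite cE setIUl; have -> : [set [set x; y]; [set m y; m x]] :&: M = set0.
    apply/setP=> f; rewrite !inE; apply/negP => /andP[/orP[]/eqP-> fM];
    by rewrite fM in xyM myxM.
  rewrite set0U (setIidPl _) ?subUset ?sub1set ?mM // cards2; congr (_.+1).
  apply/eqP; rewrite eqb1; apply/eqP => /eq_set2P[[eq _]|[eq _]];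
  by move: U; rewrite eq /= !inE !eqxx ?orbT ?andbF.
move=> z /bigcupP[f]; rewrite cE !inE => /orP[/orP[]|/orP[]] /eqP-> /set2P[]->;
by rewrite eqxx ?orbT.
Qed.

(** An edge of M with both ends on one cycle would be a chord, or else an edge
    of that cycle and thus not in M. So m exchanges the cycles, and e has
    exactly one end a on the first. *)
Lemma cut_at_edge (V : finType) (E M : {set {set V}}) (e : {set V}) :
  marked_permutation_graph E M -> e \in M ->
  exists (m : V -> V) (a : V) (s1 s2 : seq V),
  [/\ (forall x, [set x; m x] \in M) /\ involutive m,
      e = [set a; m a] /\ 1 < size s1,
      uniq ((a :: s1) ++ m a :: s2) /\ (forall x, x \in (a :: s1) ++ m a :: s2),
      E :\: M = cycle_edges (a :: s1) :|: cycle_edges (m a :: s2)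
    & forall x, (x \in s1) = (m x \in s2)].
Proof.
case=> sE _ pM [c1 [c2 [[/andP[sz1 U1] /andP[sz2 U2]]]]].
move=> [dis cov] eqEM [ch1 ch2] eM.
have [m [mM mK muniq]] := matching_partner sE pM.
have [/subsetP sME _] := pM.
have crosses c : chordless E c -> cycle_edges c \subset E :\: M ->
  forall x, x \in c -> m x \notin c.
  move=> chc /subsetP sc x xc; apply/negP => mxc.
  have sub : [set x; m x] \subset c by apply/subsetP => z /set2P[]->.
  by have := sc _ (chc _ (sME _ (mM x)) sub); rewrite inE mM.
have cross1 := crosses c1 ch1; rewrite eqEM subsetUl in cross1.
have cross2 := crosses c2 ch2; rewrite eqEM subsetUr in cross2.
have mem12 x : (x \in c1) = (m x \in c2).
  apply/idP/idP => [xc|mxc].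
    by have := cov (m x); rewrite mem_cat (negbTE (cross1 isT x xc)).
  have := cross2 isT _ mxc; rewrite mK => /negbTE xc2.
  by have := cov x; rewrite mem_cat xc2 orbF.
have [a ac eqe] : exists2 a, a \in c1 & e = [set a; m a].
  have /eqP/cards2P[x [y [_ eqxy]]] := sE e (sME e eM).
  have eqy : y = m x by apply: muniq; rewrite -eqxy.
  have := cov x; rewrite mem_cat => /orP[xc|xc].
    by exists x; rewrite // eqxy eqy.
  by exists y; rewrite ?mem12 eqy mK // setUC -eqy.
have [n1 s1 eq1] := rot_to ac; have := ac; rewrite mem12 => mac.
have [n2 s2 eq2] := rot_to mac.
have U : uniq ((a :: s1) ++ m a :: s2).
  rewrite -eq1 -eq2 cat_uniq !rot_uniq U1 U2 andbT /=; apply/hasPn => x.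
  by rewrite !mem_rot => xc2; rewrite (disjointFl dis).
exists m, a, s1, s2; split=> //.
- by split=> //; move: sz1; rewrite -(size_rot n1) eq1.
- by split=> // x; rewrite -eq1 -eq2 mem_cat !mem_rot -mem_cat.
- by rewrite -eq1 -eq2 !cycle_edges_rot.
move=> x; have := mem12 x;
  rewrite -(mem_rot n1 c1) -(mem_rot n2 c2) eq1 eq2 !inE.
rewrite (inj_eq (can_inj mK)); case: eqP => // -> _.
move: U; rewrite cat_uniq /= =>
  /and3P[/andP[/negbTE-> _] _ /andP[/negbTE-> _]] //.
Qed.

Theorem theorem2 (V : finType) (E M : {set {set V}}) (e : {set V})
  (hG : marked_permutation_graph E M) (hV : 6 <= #|V|) (he : e \in M)
  (hC4 : forall C : {set {set V}}, M_copy_C4 E M C -> e \in C) :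
  exists H : {set {set V}}, M_copy_P10 E M H /\ e \in H.
Proof.
have [m [a [s1 [s2 [[mM mK] [eqe sz1] [U cov] eqEM mem12]]]]] :=
  cut_at_edge hG he.
have sME : M \subset E by case: hG => _ _ [].
have [U1 dis U2] : [/\ uniq (a :: s1), ~~ has [in a :: s1] (m a :: s2)
    & uniq (m a :: s2)].
  by move: U; rewrite cat_uniq => /and3P[].
have Us1 : uniq s1 by case/andP: U1.
have Us2 : uniq s2 by case/andP: U2.
pose r x y := index (m x) s2 < index (m y) s2.
have lin : linear_on r s1.
  split=> [x|y x z|x y xs ys ne]; [exact: ltnn|exact: ltn_trans|].
  rewrite /r -neq_ltn; apply: contraNneq ne => eq; apply/eqP/(can_inj mK).
  by rewrite mem12 in xs; rewrite mem12 in ys; exact: index_inj xs ys eq.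
have sub_partners xs : {subset xs <= s1} -> sorted r xs -> subseq (map m xs) s2.
  move=> sub srt; apply: index_sorted_subseq.
    by move=> _ /mapP[x /sub xs1 ->]; rewrite -mem12.
  by rewrite -map_comp sorted_map.
have [[t1 [x [y [t2 [eqs1 btw]]]]]|[]] := consecutive_or_pattern lin Us1 sz1.
(* Neighbours whose partners are neighbours close a C4 avoiding e. *)
- have xs : x \in s1 by rewrite eqs1 mem_cat mem_head orbT.
  have ys : y \in s1 by rewrite eqs1 mem_cat !inE eqxx !orbT.
  have xyE : [set x; y] \in E :\: M.
    by rewrite eqEM inE; move: U1; rewrite eqs1 => /consecutive_cycle_edge->.
  have Uxy : uniq [:: x; y; m y; m x].
    have nc z z' : z \in s1 -> z' \in s1 -> z != m z'.
      move=> zs zs'; apply: contraNneq dis => eq; apply/hasP; exists z.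
        by rewrite eq inE -mem12 zs' orbT.
      by rewrite !inE zs orbT.
    have xy : x != y.
      by apply: contraTneq Us1 => eq;
        rewrite eqs1 eq cat_uniq /= mem_head !andbF.
    by rewrite /= !inE !negb_or (inj_eq (can_inj mK)) [y == x]eq_sym xy !nc.
  have adj u v : u \in s1 -> v \in s1 -> r u v ->
      {in s1, forall z, ~~ (r u z && r z v)} -> [set m u; m v] \in E :\: M.
    move=> us vs ruv btw';
      have [|||||p [q eqs2]] := @index_consecutive _ (m u) (m v) s2 => //.
    - by rewrite -mem12.
    - by rewrite -mem12.
    - move=> w ws; have := btw' (m w); rewrite /r mem12 !mK; exact.
    by rewrite eqEM !inE; move: U2; rewrite eqs2 => /consecutive_cycle_edge->;
      rewrite orbT.
  have myxE : [set m y; m x] \in E :\: M.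
    have [_ _ tot] := lin; have := tot x y xs ys; case: eqP => [eq|_].
      by move: Uxy; rewrite /= eq inE eqxx.
    case/(_ isT)/orP=> [rxy|ryx]; last by apply: adj => // z /btw/andP[].
    by rewrite setUC; apply: adj => // z /btw/andP[].
  have [C [/hC4 eC sub]] := four_cycle mM sME Uxy xyE myxE.
  have : a \in cover C by apply/bigcupP; exists e; rewrite // eqe set21.
  have as1 : a \notin s1 by case/andP: U1.
  have anc z : z \in s1 -> a != m z.
    move=> zs; apply: contraNneq dis => eq; apply/hasP; exists a;
      last by rewrite mem_head.
    by rewrite eq inE -mem12 zs orbT.
  move/sub; rewrite !inE !(negbTE (anc _ _)) // !orbF => /orP[]/eqP eq;
  by rewrite eq ?xs ?ys in as1.
- case=> x1 [x2 [x3 [x4 [sub [r24 r41 r13]]]]].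
  have := @sub_partners [:: x2; x4; x1; x3]; rewrite /= r24 r41 r13.
  move=> sub2; rewrite eqe; apply: (petersen_copy mM U cov eqEM sub);
    apply: sub2 => // z.
  by move=> zs; apply: (mem_subseq sub); move: zs; rewrite !inE => /or4P[]->;
    rewrite ?orbT.
- case=> x1 [x2 [x3 [x4 [sub [r42 r14 r31]]]]].
  (* The pattern 2413 in s2 is the pattern 3142 in rev s2. *)
  have := @sub_partners [:: x3; x1; x4; x2];
    rewrite /= (r42 : r x4 x2) (r14 : r x1 x4) (r31 : r x3 x1).
  move=> sub2; rewrite eqe;
    apply: (@petersen_copy _ E M m a x1 x2 x3 x4 s1 (rev s2)) => //.
  + by move: U; rewrite !cat_uniq /= mem_rev rev_uniq has_rev.
  + by move=> x; have := cov x; rewrite !mem_cat !inE mem_rev.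
  + by rewrite cycle_edges_rev_tail.
  rewrite -subseq_rev revK; apply: sub2 => // z.
  by move=> zs; apply: (mem_subseq sub); move: zs; rewrite !inE => /or4P[]->;
    rewrite ?orbT.
Qed.
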